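(* Let $a=-3$ and $b=\beta^2$ with $\beta\in\mathbb R$, $\beta\neq0$, and consider the classical metric $g$ on the region $r>0$, $0<\theta<\pi$, in coordinates $(t,r,\theta,\phi)$, $$g=b\,r^2\,\mathrm dt^2-2b\,r\,t\,\mathrm dr\,\mathrm dt+(a+b\,t^2)\,\mathrm dr^2+r^2(\mathrm d\theta^2+\sin^2\theta\,\mathrm d\phi^2).$$ Let $u=\frac1{\sqrt3}(t/r,1,0,0)$. Then $g_{ij}u^iu^j=-1$ and the Einstein tensor satisfies $$G^{ij}=-\frac{4}{3r^2}g^{ij}+\frac{4}{3r^2}u^iu^j .$$ Hence $G^{ij}=8\pi G_N T^{ij}$ where $T^{ij}=p\,g^{ij}+(p+\rho)u^iu^j$ is the stress tensor of a perfect fluid with pressure $p=-\dfrac{1}{6\pi G_N r^2}$ and density $\rho=\dfrac{1}{3\pi G_N r^2}$, so that $w_Q:=p/\rho=-\tfrac12$.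
   Context: $G_{ij}=R_{ij}-\tfrac12 S g_{ij}$ is the usual Einstein tensor of the Levi-Civita connection (signature $-+++$, sign conventions such that the round sphere has positive Ricci curvature), $G^{ij}$ is obtained by raising indices with $g$, and $G_N>0$ is the gravitational constant (units with speed of light 1). $T^{ij}=p\,g^{ij}+(p+\rho)u^iu^j$ is the perfect fluid stress-energy tensor with normalised 4-velocity $u$, pressure $p$, energy density $\rho$. *)

(* Defs.v *)
From HB Require Import structures.
From mathcomp Require Import all_boot all_order all_algebra.
From mathcomp Require Import all_classical all_reals all_analysis.

Set Implicit Arguments.
Unset Strict Implicit.
Unset Printing Implicit Defensive.

Import Order.TTheory GRing.Theory Num.Theory.
Import numFieldNormedType.Exports.

Local Open Scope ring_scope.

(* Pseudo-Riemannian geometry in one coordinate chart of dimension n.  A point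
   is its row of coordinates, and the matrix g x holds the components g_ij(x).
   The operations are total: they have their usual meaning at points where g is
   smooth, symmetric and invertible. *)
Section Chart.
Context {R : realType} {n : nat}.
Implicit Types (g : 'rV[R]_n -> 'M[R]_n) (x : 'rV[R]_n) (i j k l m : 'I_n).

Definition pderiv i (f : 'rV[R]_n -> R) x : R := 'D_('e_i) f x.

(* g^{ij} *)
Definition inv_metric g x : 'M[R]_n := invmx (g x).

(* Gamma^k_{ij}, the components of the Levi-Civita connection *)
Definition christoffel g k i j x : R :=
  2^-1 * \sum_(l < n) inv_metric g x k l *
    (pderiv i (fun y => g y l j) x + pderiv j (fun y => g y l i) x
     - pderiv l (fun y => g y i j) x).

(* The d_l-component of R(d_i, d_j) d_k, where
   R(X, Y) = [nabla_X, nabla_Y] - nabla_[X, Y]. *)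
Definition riemann g l k i j x : R :=
  pderiv i (christoffel g l j k) x - pderiv j (christoffel g l i k) x
  + \sum_(m < n) (christoffel g l i m x * christoffel g m j k x
                  - christoffel g l j m x * christoffel g m i k x).

(* R_{kj} is the trace of X |-> R(X, d_j) d_k, which is positive on round
   spheres. *)
Definition ricci g x : 'M[R]_n :=
  \matrix_(k, j) \sum_(i < n) riemann g i k i j x.

Definition scalar_curvature g x : R :=
  \sum_(i < n) \sum_(j < n) inv_metric g x i j * ricci g x i j.

(* G_{ij} *)
Definition einstein g x : 'M[R]_n :=
  \matrix_(i, j) (ricci g x i j - 2^-1 * scalar_curvature g x * g x i j).

(* G^{ij} *)
Definition einstein_up g x : 'M[R]_n :=
  \matrix_(i, j) \sum_(k < n) \sum_(l < n)
    inv_metric g x i k * inv_metric g x j l * einstein g x k l.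

(* T^{ij} for a perfect fluid of 4-velocity u, pressure p and density rho *)
Definition perfect_fluid g (u : 'rV[R]_n -> 'rV[R]_n)
    (p rho : 'rV[R]_n -> R) x : 'M[R]_n :=
  \matrix_(i, j) (p x * inv_metric g x i j
                  + (p x + rho x) * (u x 0 i * u x 0 j)).

End Chart.

Section Spacetime.
Context {R : realType}.
Implicit Types (x : 'rV[R]_4).

Definition coord_t x : R := x 0 (@Ordinal 4 0 isT).
Definition coord_r x : R := x 0 (@Ordinal 4 1 isT).
Definition coord_theta x : R := x 0 (@Ordinal 4 2 isT).

(* Rows and columns are in the order t, r, theta, phi.  The cross term
   -2 b r t dr dt is split evenly between g_tr and g_rt. *)
Definition metric (a b : R) x : 'M[R]_4 :=
  let t := coord_t x in let r := coord_r x in let theta := coord_theta x in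
  \matrix_(i < 4, j < 4)
    nth 0 (nth [::]
      [:: [:: b * r ^+ 2;     - (b * r * t);    0;      0];
          [:: - (b * r * t);  a + b * t ^+ 2;   0;      0];
          [:: 0;              0;                r ^+ 2; 0];
          [:: 0;              0;                0;      r ^+ 2 * sin theta ^+ 2]]
      i) j.

Definition velocity x : 'rV[R]_4 :=
  (Num.sqrt 3)^-1 *:
    \row_(j < 4) nth 0 [:: coord_t x / coord_r x; 1; 0; 0] j.

Definition pressure (GN : R) x : R := - (1 / (6 * pi * GN * coord_r x ^+ 2)).

Definition density (GN : R) x : R := 1 / (3 * pi * GN * coord_r x ^+ 2).

End Spacetime.

(* Main.v *)
(** Since [r dt - t dr = r^2 d(t/r)], the metric is
    [b r^4 d(t/r)^2 + a dr^2 + r^2 dOmega^2].  Read in the coordinates [(t, r)],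
    its Christoffel symbols are rational functions of [t], [r], [sin theta] and
    [cos theta]; differentiating them gives the Ricci tensor
    [- 6 (b / a) r^2 d(t/r)^2 - (2 / r^2) dr^2 + (1 - 3 / a) dOmega^2] and the
    scalar curvature [(2 - 14 / a) / r^2], for all nonzero [a] and [b].  Partial
    derivatives are computed on syntactic expressions, whose differentiation
    rule is proved correct once. *)

Require Import Defs.
From mathcomp Require Import all_boot all_order all_algebra.
From mathcomp Require Import all_classical all_reals all_analysis.
From mathcomp Require Import ring.

Import Order.TTheory GRing.Theory Num.Theory.
Import numFieldNormedType.Exports.

Local Open Scope ring_scope.

(** * Indices in dimension four and matrix inverses *)

Local Notation o0 := (@Ordinal 4 0 isT).
Local Notation o1 := (@Ordinal 4 1 isT).
Local Notation o2 := (@Ordinal 4 2 isT).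
Local Notation o3 := (@Ordinal 4 3 isT).

(** Bound proofs become the literal [isT], so that tables read by [nth] or [match] compute. *)
Lemma ord4_ind (P : 'I_4 -> Prop) :
  P o0 -> P o1 -> P o2 -> P o3 -> forall i, P i.
Proof.
move=> P0 P1 P2 P3 [[|[|[|[|//]]]] lti];
  by rewrite (bool_irrelevance lti isT).
Qed.

Lemma big_ord4 (V : nmodType) (F : 'I_4 -> V) :
  \sum_(i < 4) F i = F o0 + F o1 + F o2 + F o3.
Proof.
rewrite !big_ord_recr big_ord0 /= add0r.
by congr (F _ + F _ + F _ + F _); apply/val_inj.
Qed.

(** A one-sided inverse of a square matrix is two-sided, so a candidate is checked by a single
    product. *)
Lemma invmx_eq {F : comUnitRingType} {n : nat} (A B : 'M[F]_n) :
  A *m B = 1%:M -> invmx A = B.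
Proof.
move=> AB1; have [uA _] := mulmx1_unit AB1.
by rewrite -[RHS](mulKmx uA) AB1 mulmx1.
Qed.

(** * Symbolic partial derivatives *)

Section Calculus.
Context {R : realType}.

Inductive expr : Type :=
  | ECst of R | ECoord of 'I_4 | ESin | ECos
  | EOpp of expr | EAdd of expr & expr | EMul of expr & expr | EInv of expr.

Implicit Types (e : expr) (x : 'rV[R]_4).

Fixpoint expr_eval e x : R :=
  match e with
  | ECst c => c
  | ECoord i => x 0 i
  | ESin => sin (coord_theta x)
  | ECos => cos (coord_theta x)
  | EOpp e => - expr_eval e x
  | EAdd e1 e2 => expr_eval e1 x + expr_eval e2 x
  | EMul e1 e2 => expr_eval e1 x * expr_eval e2 x
  | EInv e => (expr_eval e x)^-1
  end.

Fixpoint expr_diff (i : 'I_4) e : expr :=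
  match e with
  | ECst _ => ECst 0
  | ECoord j => ECst (i == j)%:R
  | ESin => EMul ECos (ECst (i == o2)%:R)
  | ECos => EMul (EOpp ESin) (ECst (i == o2)%:R)
  | EOpp e => EOpp (expr_diff i e)
  | EAdd e1 e2 => EAdd (expr_diff i e1) (expr_diff i e2)
  | EMul e1 e2 => EAdd (EMul (expr_diff i e1) e2) (EMul e1 (expr_diff i e2))
  | EInv e => EOpp (EMul (EMul (EInv e) (EInv e)) (expr_diff i e))
  end.

(** Inversion is total, with [0^-1 = 0]; the differentiation rule is proved where every inverted
    subexpression is nonzero. *)
Fixpoint expr_defined e x : Prop :=
  match e with
  | EOpp e => expr_defined e x
  | EAdd e1 e2 | EMul e1 e2 => expr_defined e1 x /\ expr_defined e2 x
  | EInv e => expr_eval e x != 0 /\ expr_defined e x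
  | _ => True
  end.

Lemma is_derive_coord (m n : nat) (x v : 'M[R]_(m.+1, n.+1)) i j :
  is_derive x v (fun y => y i j : R) (v i j).
Proof.
apply: DeriveDef; first exact/diff_derivable/differentiable_coord.
have := derive_mx (@derivable_id _ _ x v).
by move=> /matrixP/(_ i j); rewrite derive_id mxE.
Qed.

Lemma is_derive_comp1 (V : normedModType R) (f : V -> R) (h : R -> R)
    (x v : V) (dh : R) :
  differentiable f x -> is_derive (f x) 1 h dh ->
  is_derive x v (h \o f) (dh * 'D_v f x).
Proof.
move=> df [/derivable1_diffP dh' <-].
apply: DeriveDef; first exact/diff_derivable/differentiable_comp.
rewrite deriveE; last exact: differentiable_comp.
rewrite diff_comp //= diff1E // derive1E mulrC.
by rewrite (deriveE _ df).
Qed.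

Lemma is_derive_eval i e x :
  expr_defined e x ->
  is_derive x ('e_i) (expr_eval e) (expr_eval (expr_diff i e) x).
Proof.
elim: e => [c|j|||e IH|e1 IH1 e2 IH2|e1 IH1 e2 IH2|e IH] /=.
- by move=> _; exact: is_derive_cst.
- move=> _; rewrite (_ : (i == j)%:R = ('e_i : 'rV[R]_4) 0 j); last first.
    by rewrite mxE eqxx eq_sym.
  exact: is_derive_coord.
(* The Kronecker factor is the derivative of theta along ['e_i], which puts the goal in the shape of
   the chain rule. *)
- move=> _; rewrite (_ : (i == o2)%:R = 'D_('e_i) (@coord_theta R) x).
    by apply: is_derive_comp1; exact: differentiable_coord.
  have [_ ->] := is_derive_coord 0 3 x 'e_i 0 o2.
  by rewrite mxE eqxx eq_sym.
- move=> _; rewrite (_ : (i == o2)%:R = 'D_('e_i) (@coord_theta R) x).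
    by apply: is_derive_comp1; exact: differentiable_coord.
  have [_ ->] := is_derive_coord 0 3 x 'e_i 0 o2.
  by rewrite mxE eqxx eq_sym.
- by move=> /IH ?; exact: is_deriveN.
- by move=> [/IH1 ? /IH2 ?]; exact: is_deriveD.
- move=> [/IH1 d1 /IH2 d2]; apply: is_derive_eq.
  by rewrite /GRing.scale /= addrC [_ * expr_eval e2 x]mulrC.
- move=> [e0 /IH [de <-]]; apply: DeriveDef; first exact: derivableV.
  rewrite deriveV // /GRing.scale /= -mulNr; congr (_ * _).
  by rewrite -exprVn expr2.
Qed.

Lemma pderiv_eval i e x : expr_defined e x ->
  pderiv i (expr_eval e) x = expr_eval (expr_diff i e) x.
Proof. by move=> /(is_derive_eval i) [_]. Qed.

End Calculus.

(** * Closed forms for the connection and the curvature *)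

Section Curvature.
Context {R : realType} (a b : R).
Hypotheses (a0 : a != 0) (b0 : b != 0).
Implicit Types (x : 'rV[R]_4) (i j k l : 'I_4).

Local Notation t := (ECoord o0).
Local Notation r := (ECoord o1).
Local Notation sq e := (EMul e e).

Definition metric_expr i j : @expr R :=
  match nat_of_ord i, nat_of_ord j with
  | 0, 0 => EMul (ECst b) (sq r)
  | 0, 1 | 1, 0 => EOpp (EMul (EMul (ECst b) r) t)
  | 1, 1 => EAdd (ECst a) (EMul (ECst b) (sq t))
  | 2, 2 => sq r
  | 3, 3 => EMul (sq r) (sq ESin)
  | _, _ => ECst 0
  end.

(** The [(t, r)] block of the metric has determinant [a b r^2], free of [t]. *)
Definition inv_metric_expr i j : @expr R :=
  match nat_of_ord i, nat_of_ord j with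
  | 0, 0 => EMul (EAdd (ECst b^-1) (EMul (ECst a^-1) (sq t))) (sq (EInv r))
  | 0, 1 | 1, 0 => EMul (ECst a^-1) (EMul t (EInv r))
  | 1, 1 => ECst a^-1
  | 2, 2 => sq (EInv r)
  | 3, 3 => sq (EMul (EInv r) (EInv ESin))
  | _, _ => ECst 0
  end.

Definition christoffel_expr k i j : @expr R :=
  match nat_of_ord k, nat_of_ord i, nat_of_ord j with
  | 0, 0, 0 => EMul (ECst (- (2 * b / a))) t
  | 0, 0, 1 | 0, 1, 0 =>
      EMul (EAdd (ECst 1) (EMul (ECst (2 * b / a)) (sq t))) (EInv r)
  | 0, 1, 1 =>
      EMul (EMul (ECst (- 2)) (EAdd (ECst 1) (EMul (ECst (b / a)) (sq t))))
        (EMul t (sq (EInv r)))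
  | 0, 2, 2 => EMul (ECst (- a^-1)) t
  | 0, 3, 3 => EMul (ECst (- a^-1)) (EMul t (sq ESin))
  | 1, 0, 0 => EMul (ECst (- (2 * b / a))) r
  | 1, 0, 1 | 1, 1, 0 => EMul (ECst (2 * b / a)) t
  | 1, 1, 1 => EMul (ECst (- (2 * b / a))) (EMul (sq t) (EInv r))
  | 1, 2, 2 => EMul (ECst (- a^-1)) r
  | 1, 3, 3 => EMul (ECst (- a^-1)) (EMul r (sq ESin))
  | 2, 1, 2 | 2, 2, 1 => EInv r
  | 2, 3, 3 => EOpp (EMul ESin ECos)
  | 3, 1, 3 | 3, 3, 1 => EInv r
  | 3, 2, 3 | 3, 3, 2 => EMul ECos (EInv ESin)
  | _, _, _ => ECst 0
  end.

(** The tables invert only [r] and [sin theta] among functions of the point. *)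
Definition regular x : Prop := coord_r x != 0 /\ sin (coord_theta x) != 0.

Lemma metricE i j x : metric a b x i j = expr_eval (metric_expr i j) x.
Proof.
by elim/ord4_ind: j; elim/ord4_ind: i;
  rewrite mxE /= /coord_t /coord_r ?expr2.
Qed.

Lemma pderiv_metric k i j x :
  pderiv k (fun y => metric a b y i j) x
  = expr_eval (expr_diff k (metric_expr i j)) x.
Proof.
rewrite (_ : (fun y => _) = expr_eval (metric_expr i j)); last first.
  by apply/funext => y; exact: metricE.
apply: pderiv_eval.
by elim/ord4_ind: j; elim/ord4_ind: i.
Qed.

Lemma inv_metricE i j x : regular x ->
  inv_metric (metric a b) x i j = expr_eval (inv_metric_expr i j) x.
Proof.
rewrite /regular /coord_r => -[r0 s0]; rewrite /inv_metric.
pose B := \matrix_(k, l) expr_eval (inv_metric_expr k l) x.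
rewrite (@invmx_eq _ _ _ B) ?mxE //.
apply/matrixP => k l; rewrite !mxE big_ord4 !metricE !mxE.
by elim/ord4_ind: l; elim/ord4_ind: k => /=; field;
  rewrite ?a0 ?b0 ?r0 ?s0.
Qed.

Lemma christoffelE k i j x : regular x ->
  christoffel (metric a b) k i j x = expr_eval (christoffel_expr k i j) x.
Proof.
move=> reg; have [r0 s0] := reg; rewrite /coord_r in r0.
rewrite /christoffel big_ord4 !inv_metricE // !pderiv_metric.
by elim/ord4_ind: k; elim/ord4_ind: i; elim/ord4_ind: j
  => /=; field; rewrite ?a0 ?b0 ?r0 ?s0.
Qed.

(** The condition is open since [r] and [sin theta] are continuous; formulas valid at regular points
    can therefore be differentiated there. *)
Lemma near_regular x : regular x -> (\near x, regular x)%classic.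
Proof.
move=> [r0 s0].
have cvg_coord i : (y 0 i @[y --> x] --> x 0 i)%classic
  by exact: coord_continuous.
apply: filterI; first exact: cvgr_neq0 (cvg_coord _) r0.
have cvg_sin : (sin (coord_theta y) @[y --> x] --> sin (coord_theta x))%classic.
  exact: (cvg_comp _ _ (cvg_coord o2) (@continuous_sin R _)).
exact: cvgr_neq0 cvg_sin s0.
Qed.

Lemma pderiv_christoffel l k i j x : regular x ->
  pderiv l (christoffel (metric a b) k i j) x
  = expr_eval (expr_diff l (christoffel_expr k i j)) x.
Proof.
move=> reg; rewrite -pderiv_eval.
  (* A derivative depends only on the germ of the function, and the closed form holds on a
     neighbourhood of [x]. *)
  apply: near_eq_derive; have := near_regular _ reg.
  by apply: filterS => y; exact: christoffelE.
have [r0 s0] := reg.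
by elim/ord4_ind: k; elim/ord4_ind: i; elim/ord4_ind: j.
Qed.

Definition ricci_expr i j : @expr R :=
  match nat_of_ord i, nat_of_ord j with
  | 0, 0 => ECst (- (6 * b / a))
  | 0, 1 | 1, 0 => EMul (ECst (6 * b / a)) (EMul t (EInv r))
  | 1, 1 => EMul (ECst (- 2))
      (EMul (EAdd (ECst 1) (EMul (ECst (3 * b / a)) (sq t))) (sq (EInv r)))
  | 2, 2 => ECst (1 - 3 / a)
  | 3, 3 => EMul (ECst (1 - 3 / a)) (sq ESin)
  | _, _ => ECst 0
  end.

Lemma ricciE i j x : regular x ->
  ricci (metric a b) x i j = expr_eval (ricci_expr i j) x.
Proof.
move=> reg; have [r0 s0] := reg; rewrite /coord_r in r0.
rewrite mxE big_ord4 /riemann !big_ord4 !pderiv_christoffel // !christoffelE //.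
(* The cosine terms cancel without [sin^2 + cos^2 = 1], so [field] can treat sine and cosine as
   independent. *)
by elim/ord4_ind: i; elim/ord4_ind: j
  => /=; field; rewrite ?a0 ?b0 ?r0 ?s0.
Qed.

(** The directions of [d(t/r)], [dr] and the sphere contribute [- 6 / a], [- 2 / a] and
    [2 (1 - 3 / a)] to the trace, each over [r^2]. *)
Lemma scalar_curvatureE x : regular x ->
  scalar_curvature (metric a b) x = (2 - 14 / a) / coord_r x ^+ 2.
Proof.
move=> reg; have [r0 s0] := reg; rewrite /coord_r in r0 *.
rewrite /scalar_curvature !big_ord4 !ricciE // !inv_metricE //=.
by field; rewrite ?a0 ?b0 ?r0 ?s0.
Qed.

Lemma einsteinE i j x : regular x ->
  einstein (metric a b) x i j =
  expr_eval (ricci_expr i j) x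
  - 2^-1 * ((2 - 14 / a) / coord_r x ^+ 2) * expr_eval (metric_expr i j) x.
Proof. by move=> reg; rewrite mxE ricciE // scalar_curvatureE // metricE. Qed.

End Curvature.

(** * The fluid and the field equation *)

Lemma velocityM (R : realType) (x : 'rV[R]_4) i j :
  velocity x 0 i * velocity x 0 j =
  3^-1 * (nth 0 [:: coord_t x / coord_r x; 1; 0; 0] i *
          nth 0 [:: coord_t x / coord_r x; 1; 0; 0] j).
(* The velocity enters quadratically, so the square root disappears and only rational identities
   remain. *)
Proof. by rewrite !mxE mulrACA -invfM -expr2 sqr_sqrtr // ler0n. Qed.

Theorem mainTheorem5 (R : realType) (a b beta GN : R)
    (ha : a = -3) (hb : b = beta ^+ 2) (hbeta : beta != 0) (hGN : 0 < GN)
    (x : 'rV[R]_4) (hr : 0 < coord_r x)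
    (htheta0 : 0 < coord_theta x) (htheta1 : coord_theta x < pi) :
  let g := metric a b in
  let u := velocity in
  let r := coord_r x in
  let p := pressure GN in
  let rho := density GN in
  [/\ \sum_(i < 4) \sum_(j < 4) g x i j * u x 0 i * u x 0 j = -1,
      forall i j : 'I_4,
        einstein_up g x i j =
          - (4 / (3 * r ^+ 2)) * inv_metric g x i j
          + 4 / (3 * r ^+ 2) * (u x 0 i * u x 0 j),
      forall i j : 'I_4,
        einstein_up g x i j = 8 * pi * GN * perfect_fluid g u p rho x i j
    & p x / rho x = - (1 / 2)].
Proof.
move=> g u r p rho.
have b0 : b != 0 by rewrite hb expf_neq0.
have a0 : a != 0 by rewrite ha oppr_eq0 pnatr_eq0.
have r0 : coord_r x != 0 by rewrite gt_eqF.
have s0 : sin (coord_theta x) != 0.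
  by rewrite gt_eqF // sin_gt0_pi // htheta0 htheta1.
have reg : regular x by [].
have GN0 : GN != 0 by rewrite gt_eqF.
have pi0 : (pi : R) != 0 by rewrite gt_eqF // pi_gt0.
have einstein_upE i j : einstein_up g x i j =
    - (4 / (3 * r ^+ 2)) * inv_metric g x i j
    + 4 / (3 * r ^+ 2) * (u x 0 i * u x 0 j).
  rewrite /g /u velocityM mxE !big_ord4 !einsteinE // !inv_metricE //.
  (* At [a = -3] the Ricci eigenvalues along [d(t/r)] and the sphere, [- 6 / (a r^2)] and
     [(1 - 3 / a) / r^2], coincide; only the direction of [u] differs, as for a perfect fluid. *)
  rewrite /r /coord_t /coord_r ha in r0 *.
  by elim/ord4_ind: i; elim/ord4_ind: j => /=; field; rewrite ?b0 ?r0 ?s0.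
split => //.
(* Since [d(t/r)] vanishes on [u], only [a dr^2] contributes, giving [a / 3 = -1]. *)
- under eq_bigr do under eq_bigr do rewrite -mulrA velocityM metricE.
  rewrite !big_ord4 /= /coord_t /coord_r ha in r0 *.
  by field.
- move=> i j; rewrite einstein_upE [perfect_fluid _ _ _ _ _ _ _]mxE.
  rewrite /p /rho /pressure /density -/r.
  (* Only [pi != 0] matters: pi is generalised to a nonzero scalar that cancels. *)
  by move: (pi : R) pi0 => c c0; field; rewrite r0 GN0 c0.
- rewrite /p /rho /pressure /density.
  by move: (pi : R) pi0 => c c0; field; rewrite ?r0 ?GN0 ?c0.
Qed.
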